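(* Let $p$ be a prime, let $G_\delta$ be a finite group of order $\delta\le p+2$, let $G_\delta^{\times}=G_\delta\setminus\{1\}$, $V=\mathbb{F}_p^2$ and $X=V\times G_\delta$. Let $P(V)$ be the set of the $p+1$ subgroups of $V$ of order $p$. Let $a\mapsto L_a$ be an injective mapping from $G_\delta^{\times}$ to $P(V)$, and let $a\mapsto C_a$ be a mapping from $G_\delta^{\times}$ to $P(V)$ such that $L_a\ne C_a=C_{a^{-1}}$ for all $a\in G_\delta^{\times}$. Writing $u_a$ for $(u,a)\in X$, define binary relations on $X$ by $$h_w=\{(u_a,v_a)\mid u-v=w,\ a\in G_\delta\}\quad (w\in V),$$ $$t_a=\Big\{(u_b,v_c)\ \Big|\ b^{-1}c=a,\ (u,v)\in\bigcup_{x\in C_a}(L_a+x)\times(L_{a^{-1}}+x)\Big\}\quad (a\in G_\delta^{\times}),$$ and $t_1=1_X=\{(x,x)\mid x\in X\}$. Put $S=\{t_a\cdot h_w\mid w\in V,\ a\in G_\delta\}$. Then $S$ is an association scheme on $X$.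
   Context: An association scheme on a non-empty set $X$ is a partition $S$ of $X\times X$ such that (1) $1_X=\{(x,x)\mid x\in X\}\in S$; (2) for each $s\in S$, $s^*=\{(x,y)\mid (y,x)\in s\}\in S$; (3) for all $s,t,u\in S$, the number $c_{st}^u=|xs\cap yt^*|$ is the same for all $(x,y)\in u$, where $xs=\{y\in X\mid (x,y)\in s\}$. For binary relations $r,s\subseteq X\times X$, $r\cdot s=\{(\alpha,\gamma)\mid (\alpha,\beta)\in r,\ (\beta,\gamma)\in s\text{ for some }\beta\in X\}$. $S$ is regarded as a set of relations (coinciding relations $t_a\cdot h_w$ are counted once). *)

(* Defs.v *)
From mathcomp Require Import all_boot all_order all_algebra all_fingroup.

Set Implicit Arguments.
Unset Strict Implicit.
Unset Printing Implicit Defensive.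

Import GRing.Theory.

Section Relations.
Variable X : finType.
Implicit Types (r s t u : {set X * X}) (S : {set {set X * X}}).

Definition diagonal : {set X * X} := [set z | z.1 == z.2].

Definition converse s : {set X * X} := [set z | (z.2, z.1) \in s].

Definition nbhd x s : {set X} := [set y | (x, y) \in s].

Definition relprod r s : {set X * X} :=
  [set z | [exists b, ((z.1, b) \in r) && ((b, z.2) \in s)]].

Definition association_scheme S : Prop :=
  [/\ 0 < #|X|,
      partition S [set: X * X],
      diagonal \in S,
      forall s, s \in S -> converse s \in S
    & forall s t u, s \in S -> t \in S -> u \in S ->
      exists c : nat, forall x y, (x, y) \in u ->
        #|nbhd x s :&: nbhd y (converse t)| = c].

End Relations.

Notation plane p := 'rV['F_p]_2.

(* Groups in {group plane p} are subgroups for the finGroupType structure that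
   MathComp puts on every finite Z-module, whose law is addition. *)
Definition order_p_subgroups (p : nat) : {set {group plane p}} :=
  [set H : {group plane p} | #|H| == p].

Section Construction.
Variables (p : nat) (gT : finGroupType).
Implicit Types (a b c : gT) (u v w x : plane p).

Definition translate (H : {set plane p}) x : {set plane p} :=
  [set (l + x)%R | l in H].

Definition h_rel w : {set (plane p * gT) * (plane p * gT)} :=
  [set z | (z.1.2 == z.2.2) && (z.1.1 - z.2.1 == w)%R].

(* The values of L and C at 1 are never used. *)
Variables L C : gT -> {group plane p}.

Definition t_rel a : {set (plane p * gT) * (plane p * gT)} :=
  if a == 1%g then diagonal (plane p * gT)%type else
  [set z | ((z.1.2^-1 * z.2.2)%g == a) &&
    ((z.1.1, z.2.1) \in
       \bigcup_(x in C a) setX (translate (L a) x) (translate (L a^-1%g) x))].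

Definition scheme_rels : {set {set (plane p * gT) * (plane p * gT)}} :=
  [set relprod (t_rel a) (h_rel w) | w in [set: plane p], a in [set: gT]].

End Construction.

(* Main.v *)
Require Import Defs.
From mathcomp Require Import all_boot all_order all_algebra all_fingroup.

Set Implicit Arguments.
Unset Strict Implicit.
Unset Printing Implicit Defensive.

(** Let [proj a] be the projection of the plane onto [C a] along [L a], and let
    [proj 1] be the identity. The relations of the scheme are the fibres of
    [(u_b, v_c) |-> (a, proj a u - proj a^-1 v)], where [a = b^-1 * c].
    For the intersection numbers, the point is that [proj (a * b) u =
    proj (a * b)^-1 v] forces some [w] with [proj a^-1 w = proj a u] and
    [proj b w = proj b^-1 v]: applied to the differences of two pairs in the same
    relation, it provides a translation carrying the intermediate points of one
    pair to those of the other. When [a], [b] and [a * b] are nontrivial, [w]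
    exists because [L a^-1] and [L b] are distinct and hence span the plane;
    when [a * b = 1], because [proj a] and [proj a^-1] have the same image. *)

Lemma fibers_partition (X : finType) (T : eqType) (f : X -> T) (S : {set {set X}}) :
    (forall s : {set X}, reflect (exists x, s = [set y | f y == f x]) (s \in S)) ->
  partition S [set: X].
Proof.
move=> SP.
suff -> : S = preim_partition f [set: X] by apply: preim_partitionP.
apply/setP=> s; apply/SP/imsetP.
- by case=> z0 ->; exists z0 => //; apply/setP=> z; rewrite !inE eq_sym.
- by case=> z0 _ ->; exists z0; apply/setP=> z; rewrite !inE eq_sym.
Qed.

(** Distinct subgroups of prime order [p] meet trivially, so their product has [p * p] elements, as
    many as the plane. *)
Lemma order_p_compl (p : nat) (H K : {group plane p}) :
    prime p ->
    H \in order_p_subgroups p -> K \in order_p_subgroups p -> H <> K ->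
  K \in [complements to H in [set: plane p]]%g.
Proof.
move=> p_prime; rewrite !inE => /eqP cardH /eqP cardK neHK.
have tiHK : (H :&: K = 1)%g.
  apply: prime_TIg; first by rewrite cardH.
  apply/negP=> sHK; apply: neHK; apply/group_inj/eqP.
  by rewrite eqEcard sHK cardH cardK leqnn.
rewrite tiHK eqxx /= eqEcard subsetT cardsT card_mx card_Fp //.
by rewrite TI_cardMg // cardH cardK mulnn mul1n leqnn.
Qed.

Section Projections.
Variables (p : nat) (gT : finGroupType) (L C : gT -> {group plane p}).
Hypothesis p_prime : prime p.
Hypothesis L_sub : forall a : gT, a != 1%g -> L a \in order_p_subgroups p.
Hypothesis C_sub : forall a : gT, a != 1%g -> C a \in order_p_subgroups p.
Hypothesis L_inj : forall a b : gT, a != 1%g -> b != 1%g -> L a = L b -> a = b.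
Hypothesis L_neq_C : forall a : gT, a != 1%g -> L a <> C a.
Hypothesis C_inv : forall a : gT, a != 1%g -> C a = C a^-1%g.

Import GRing.Theory.
Local Open Scope ring_scope.

Implicit Types (a b : gT) (u v w : plane p).

Definition proj a u : plane p := if a == 1%g then u else remgr (L a) (C a) u.

Lemma proj1 u : proj 1%g u = u.
Proof. by rewrite /proj eqxx. Qed.

Lemma LC_compl a : a != 1%g -> C a \in [complements to L a in [set: plane p]]%g.
Proof.
by move=> a1; apply: order_p_compl => //; [apply: L_sub|apply: C_sub|apply: L_neq_C].
Qed.

Lemma projD a u v : proj a (u + v) = proj a u + proj a v.
Proof.
rewrite /proj; case: ifPn => // a1.
have nL : (L a <| [set: plane p])%g.
  by rewrite -sub_abelian_normal ?subsetT ?FinRing.zmod_abelian.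
by rewrite -!FinRing.zmodMgE (remgrM (LC_compl a1) nL) ?inE.
Qed.

Lemma proj0 a : proj a 0 = 0.
Proof. by apply: (addrI (proj a 0)); rewrite -projD !addr0. Qed.

Lemma projN a u : proj a (- u) = - proj a u.
Proof. by apply/eqP; rewrite -subr_eq0 opprK -projD addNr proj0. Qed.

Lemma projB a u v : proj a (u - v) = proj a u - proj a v.
Proof. by rewrite projD projN. Qed.

Lemma proj_L a u : a != 1%g -> u \in L a -> proj a u = 0.
Proof. by move=> a1 Lu; rewrite /proj (negPf a1) remgr1 // FinRing.zmod1gE. Qed.

Lemma proj_Dr a u v : a != 1%g -> u \in L a -> v \in C a -> proj a (u + v) = v.
Proof.
move=> a1 Lu Cv; rewrite /proj (negPf a1) -FinRing.zmodMgE remgrMid //.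
by have /complP[] := LC_compl a1.
Qed.

Lemma proj_C a u : a != 1%g -> proj a u \in C a.
Proof.
move=> a1; rewrite /proj (negPf a1) mem_remgr //.
by have /complP[_ ->] := LC_compl a1; rewrite inE.
Qed.

Lemma sub_proj_L a u : a != 1%g -> u - proj a u \in L a.
Proof.
move=> a1; have /complP[_ LC] := LC_compl a1.
have : u \in (L a * C a)%g by rewrite LC inE.
by case/mulsgP=> l c Ll Cc ->; rewrite FinRing.zmodMgE proj_Dr // addrK.
Qed.

(** For nontrivial [a], [proj a^-1] fixes [C a^-1 = C a] pointwise, so [proj a u] is its own
    preimage. *)
Lemma proj_image_inv a u : exists w, proj a^-1%g w = proj a u.
Proof.
have [->|a1] := eqVneq a 1%g; first by exists u; rewrite invg1.
have a'1 : a^-1%g != 1%g by rewrite invg_eq1.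
exists (proj a u); rewrite -[X in proj _ X]add0r proj_Dr //.
  by rewrite -FinRing.zmod1gE group1.
by rewrite -C_inv // proj_C.
Qed.

(** Write [u - v = l + m] with [l] in [L a] and [m] in [L b]. Then [u - l = m + v] differs from [u]
    by an element killed by [proj a], and from [v] by one killed by [proj b]. *)
Lemma proj_joint_surj a b u v : a != 1%g -> b != 1%g -> a != b ->
  exists w, proj a w = proj a u /\ proj b w = proj b v.
Proof.
move=> a1 b1 ab.
have /complP[_ LL] : L b \in [complements to L a in [set: plane p]]%g.
  apply: order_p_compl => //; try exact: L_sub.
  by move/(L_inj a1 b1)/eqP; rewrite (negPf ab).
have : u - v \in (L a * L b)%g by rewrite LL inE.
case/mulsgP=> l m Ll Lm; rewrite FinRing.zmodMgE => /eqP.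
rewrite subr_eq => /eqP uE; exists (u - l).
rewrite projB (proj_L a1 Ll) // subr0; split=> //.
by rewrite uE -(addrA l m v) addrC addrK projD (proj_L b1 Lm) // add0r.
Qed.

Lemma proj_interpolation a b u v :
    proj (a * b)%g u = proj (a * b)^-1%g v ->
  exists w, proj a^-1%g w = proj a u /\ proj b w = proj b^-1%g v.
Proof.
(* If [a] or [b] is trivial, one of the two conditions determines [w], and the other becomes the
   hypothesis. *)
have [->|a1] := eqVneq a 1%g.
  by rewrite mul1g invg1 => uv; exists u.
have [->|b1] := eqVneq b 1%g.
  by rewrite mulg1 invg1 => uv; exists v.
have a'1 : a^-1%g != 1%g by rewrite invg_eq1.
have [<-|ab] := eqVneq a^-1%g b.
  rewrite mulgV invg1 !proj1 invgK => ->.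
  by have [w w_a] := proj_image_inv a v; exists w.
(* Both targets are rewritten as values of [proj a^-1] and [proj b], the form that [proj_joint_surj]
   expects. *)
move=> _; have [u1 <-] := proj_image_inv a u.
have [v1] := proj_image_inv b^-1%g v; rewrite invgK => <-.
exact: proj_joint_surj.
Qed.

Definition code (z : (plane p * gT) * (plane p * gT)) : gT * plane p :=
  let a := (z.1.2^-1 * z.2.2)%g in (a, proj a z.1.1 - proj a^-1%g z.2.1).

Lemma code_diag x : code (x, x) = (1%g, 0).
Proof. by rewrite /code /= mulVg invg1 subrr. Qed.

Lemma code_converse x y : code (y, x) = ((code (x, y)).1^-1%g, - (code (x, y)).2).
Proof. by rewrite /code /= !invMg !invgK opprB. Qed.

(** For nontrivial [a], the index [x] of the union is the common component in [C a = C a^-1] of [u]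
    along [L a] and of [v] along [L a^-1]. *)
Lemma t_rel_code a : t_rel L C a = [set z | code z == (a, 0)].
Proof.
apply/setP=> -[[u b] [v c]]; rewrite /t_rel /code inE /= xpair_eqE /= subr_eq0.
have [->|a1] := eqVneq a 1%g.
  rewrite inE /= xpair_eqE andbC -eq_mulVg1.
  by case: eqP => //= ->; rewrite mulVg invg1 !proj1.
rewrite inE /=; case: eqP => //= ->.
have a'1 : a^-1%g != 1%g by rewrite invg_eq1.
apply/bigcupP/eqP => [[x Cx] | uv].
  rewrite inE /= => /andP[/imsetP[l Ll ->] /imsetP[m Lm ->]].
  by rewrite !proj_Dr // -C_inv.
exists (proj a u); first exact: proj_C.
rewrite inE /=; apply/andP; split; apply/imsetP.
  by exists (u - proj a u); rewrite ?subrK ?sub_proj_L.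
by rewrite uv; exists (v - proj a^-1%g v); rewrite ?subrK ?sub_proj_L.
Qed.

Lemma relprod_code a w :
  relprod (t_rel L C a) (h_rel gT w) = [set z | code z == (a, proj a^-1%g w)].
Proof.
rewrite t_rel_code; apply/setP=> -[[u b] [v c]]; rewrite !inE.
apply/existsP/eqP => [[[v' c']] | []].
  rewrite !inE /= => /andP[/eqP[<- /eqP]] /[swap] /andP[/eqP-> /eqP<-].
  rewrite subr_eq0 /code /= => /eqP->.
  by rewrite projB.
(* The relation [h_w] allows no other midpoint. *)
move=> /= <- uv; exists (v + w, c); rewrite !inE /code /= eqxx.
by rewrite projD -uv addrCA subrr addr0 subrr (addrC v) addrK !eqxx.
Qed.

(** In a code [(a, k)], the vector [k] lies in the image of [proj a^-1], since [proj a] has the same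
    image; a preimage of [k] is the required [w]. *)
Lemma scheme_rels_fibers s :
  reflect (exists z0, s = [set z | code z == code z0]) (s \in scheme_rels L C).
Proof.
apply: (iffP imset2P) => [[w a _ _ ->] | [[[u b] [v c]] ->]].
  exists ((0, 1%g), (- w, a)); rewrite relprod_code /code /=.
  by rewrite invg1 mul1g proj0 projN sub0r opprK.
have [w wu] := proj_image_inv (b^-1 * c)%g u.
exists (w - v) (b^-1 * c)%g; rewrite ?inE // relprod_code /code /=.
by rewrite projB wu.
Qed.

(** An inequality suffices for the intersection numbers, because the hypothesis is symmetric in the
    two pairs. *)
Lemma card_intermediate_le s t x y x' y' : code (x, y) = code (x', y') ->
  (#|[set z | (code (x, z) == s) && (code (z, y) == t)]| <=
   #|[set z | (code (x', z) == s) && (code (z, y') == t)]|)%N.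
Proof.
case: s t x y x' y' => [a k] [b l] [u e] [v f] [u' e'] [v' f'] [ef].
rewrite -ef => /esym/eqP; rewrite subr_eq => /eqP uv.
set A := [set z | _]; have [-> | [z0 Az0]] := set_0Vmem A; first by rewrite cards0.
(* The layer of one intermediate point [z0] already ties [a * b] to the pair. *)
have ab : (e^-1 * f = a * b)%g.
  move: Az0; rewrite inE => /andP[/eqP[<- _] /eqP[<- _]].
  by rewrite -mulgA mulKVg.
have [w [wu wv]] : exists w, proj a^-1%g w = proj a (u' - u) /\
                             proj b w = proj b^-1%g (v' - v).
  apply: proj_interpolation; rewrite -ab !projB uv.
  by rewrite -(addrA (proj _ u)) (addrC (proj _ u)) addrK addrC.
(* Left multiplication by [e' * e^-1] sends [e] to [e'] and [f] to [f']. The shift by [w]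
   compensates for [u' - u] as seen by [proj a] and for [v' - v] as seen by [proj b^-1]. *)
pose g (z : plane p * gT) := (z.1 + w, (e' * e^-1 * z.2)%g).
have g_inj : injective g.
  by move=> [z d] [z' d'] [/addIr-> /mulgI->].
rewrite -(card_imset _ g_inj); apply/subset_leq_card/subsetP => _ /imsetP[[z d] Az ->].
move: Az; rewrite !inE /g /code /= => /andP[/eqP[da <-] /eqP[db <-]].
have -> : (e'^-1 * (e' * e^-1 * d) = a)%g by rewrite -!mulgA mulKg.
have -> : ((e' * e^-1 * d)^-1 * f' = b)%g.
  by rewrite !invMg invgK -!mulgA -ef mulKVg.
rewrite da db !xpair_eqE !eqxx /= !projD wu wv !projB.
apply/andP; split; apply/eqP.
  by rewrite opprD opprB addrCA (addrC (proj a u')) subrK addrC.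
by rewrite -addrA (addrAC (proj _ v')) subrr add0r.
Qed.

End Projections.

Theorem theorem3p2 (p : nat) (p_prime : prime p) (gT : finGroupType)
    (order_le : #|gT| <= p + 2)
    (L C : gT -> {group plane p})
    (L_sub : forall a : gT, a != 1%g -> L a \in order_p_subgroups p)
    (C_sub : forall a : gT, a != 1%g -> C a \in order_p_subgroups p)
    (L_inj : forall a b : gT, a != 1%g -> b != 1%g -> L a = L b -> a = b)
    (L_neq_C : forall a : gT, a != 1%g -> L a <> C a)
    (C_inv : forall a : gT, a != 1%g -> C a = C a^-1%g) :
  association_scheme (scheme_rels L C).
Proof.
have relsP := scheme_rels_fibers p_prime L_sub C_sub L_neq_C C_inv.
split.
- by apply/card_gt0P; exists (0%R, 1%g).
- exact: fibers_partition relsP.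
(* The diagonal is the fibre over [(1, 0)]: [proj 1] is the identity, so this code forces both
   coordinates to agree. *)
- apply/relsP; exists ((0%R, 1%g), (0%R, 1%g)); apply/setP=> -[[u b] [v c]].
  rewrite !inE code_diag /code /= !xpair_eqE -eq_mulVg1 andbC.
  case: eqP => //= ->.
  by rewrite mulVg invg1 !proj1 GRing.subr_eq0.
- move=> _ /relsP[[x y] ->]; apply/relsP; exists (y, x); apply/setP=> -[x' y'].
  rewrite !inE /= (code_converse _ _ x y) (code_converse _ _ x' y').
  case: (code L C (x, y)) (code L C (x', y')) => [a k] [a' k'] /=.
  by rewrite !xpair_eqE eqg_invLR GRing.eqr_oppLR.
- move=> _ _ _ /relsP[zs ->] /relsP[zt ->] /relsP[[x0 y0] ->].
  set cs := code _ _ zs; set ct := code _ _ zt.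
  exists #|[set z | (code L C (x0, z) == cs) && (code L C (z, y0) == ct)]|.
  move=> x y; rewrite inE => /eqP xy.
  have -> : nbhd x [set z | code L C z == cs] :&:
      nbhd y (converse [set z | code L C z == ct]) =
      [set z | (code L C (x, z) == cs) && (code L C (z, y) == ct)].
    by apply/setP=> z; rewrite !inE.
  by apply/eqP; rewrite eqn_leq !card_intermediate_le.
Qed.
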